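(* Let $H$ be a separable complex Hilbert space and let $B(H)$ be the C$^*$-algebra of all bounded linear operators on $H$. Then every (not necessarily linear nor continuous) weak-2-local $^*$-derivation $\Delta: B(H)\to B(H)$ is linear and is a $^*$-derivation.
   Context: A derivation on a C$^*$-algebra $A$ is a linear map $D:A\to A$ with $D(ab)=D(a)b+aD(b)$; it is a $^*$-derivation if moreover $D(a^* )=D(a)^*$ for all $a$. A (not necessarily linear) map $\Delta:A\to A$ is a weak-2-local $^*$-derivation if for every $a,b\in A$ and every $\phi\in A^*$ there exists a $^*$-derivation $D_{a,b,\phi}:A\to A$ (depending on $a,b,\phi$) such that $\phi\Delta(a)=\phi D_{a,b,\phi}(a)$ and $\phi\Delta(b)=\phi D_{a,b,\phi}(b)$. *)

(* Defs.v *)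
From HB Require Import structures.
From mathcomp Require Import all_boot all_order all_algebra.
From mathcomp Require Import complex.
From mathcomp Require Import reals.
Set Implicit Arguments. Unset Strict Implicit. Unset Printing Implicit Defensive.
Import Order.TTheory GRing.Theory Num.Theory.
Local Open Scope ring_scope.
Local Open Scope complex_scope.

Section Hilbert.
Variables (R : realType) (V : lmodType R[i]) (ip : V -> V -> R[i]).

Definition hnorm (x : V) : R[i] := sqrtC (ip x x).

Definition inner_product : Prop :=
  [/\ forall (a : R[i]) (x y z : V), ip (a *: x + y) z = a * ip x z + ip y z,
      forall x y : V, ip y x = (ip x y)^*,
      forall x : V, 0 <= ip x x
    & forall x : V, ip x x = 0 -> x = 0].

Definition hcomplete : Prop :=
  forall u : nat -> V,
    (forall e : R[i], 0 < e -> exists N : nat, forall m n : nat,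
        (N <= m)%N -> (N <= n)%N -> hnorm (u m - u n) < e) ->
    exists l : V, forall e : R[i], 0 < e -> exists N : nat, forall n : nat,
        (N <= n)%N -> hnorm (u n - l) < e.

Definition hilbert_space : Prop := inner_product /\ hcomplete.

Definition hseparable : Prop :=
  exists d : nat -> V, forall (x : V) (e : R[i]), 0 < e ->
    exists n : nat, hnorm (x - d n) < e.

Definition linop (T : V -> V) : Prop :=
  forall (a : R[i]) (x y : V), T (a *: x + y) = a *: T x + T y.

Definition opbound (M : R[i]) (T : V -> V) : Prop :=
  forall x : V, hnorm (T x) <= M * hnorm x.

Definition bop (T : V -> V) : Prop := linop T /\ exists M : R[i], opbound M T.

Definition is_adjoint (T S : V -> V) : Prop :=
  forall x y : V, ip (T x) y = ip x (S y).

(* phi belongs to the (Banach) dual B(H)^* : a linear functional on B(H)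
   with |phi T| <= C ||T|| (the operator norm being the least bound M) *)
Definition bdual (phi : (V -> V) -> R[i]) : Prop :=
  (forall (a : R[i]) (T S : V -> V), bop T -> bop S ->
      phi (fun x => a *: T x + S x) = a * phi T + phi S) /\
  exists C : R[i], forall (T : V -> V) (M : R[i]),
      bop T -> 0 <= M -> opbound M T -> `|phi T| <= C * M.

Definition blinear (D : (V -> V) -> (V -> V)) : Prop :=
  forall (a : R[i]) (T S : V -> V), bop T -> bop S ->
    D (fun x => a *: T x + S x) = (fun x => a *: D T x + D S x).

Definition derivation (D : (V -> V) -> (V -> V)) : Prop :=
  [/\ forall T, bop T -> bop (D T),
      blinear D
    & forall T S, bop T -> bop S ->
        D (fun x => T (S x)) = (fun x => D T (S x) + T (D S x))].

Definition star_derivation (D : (V -> V) -> (V -> V)) : Prop :=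
  derivation D /\
  forall T Ts, bop T -> is_adjoint T Ts -> is_adjoint (D T) (D Ts).

Definition weak_2_local_star_derivation (Delta : (V -> V) -> (V -> V)) : Prop :=
  (forall T, bop T -> bop (Delta T)) /\
  forall a b : V -> V, bop a -> bop b ->
  forall phi, bdual phi ->
    exists D, star_derivation D /\
      phi (Delta a) = phi (D a) /\ phi (Delta b) = phi (D b).

End Hilbert.

(* Main.v *)
Require Import Defs.
From HB Require Import structures.
From mathcomp Require Import all_boot all_order all_algebra.
From mathcomp Require Import complex.
From mathcomp Require Import reals boolp ring.
Set Implicit Arguments. Unset Strict Implicit. Unset Printing Implicit Defensive.
Import Order.TTheory GRing.Theory Num.Theory.
Local Open Scope ring_scope.
Local Open Scope complex_scope.

(** For bounded operators, test the local hypothesis with the functionals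
    [phi S = tr (c S)], [c] of finite rank. Every derivation of [B(H)] is a
    commutator [T |-> z T - T z] with some linear [z], so [tr (c D(c)) = 0] for
    every derivation [D]; hence [tr ((a - b) (Delta a - Delta b)) = 0] whenever
    [a - b] has finite rank. Let [t] be the rank-one operator
    [v |-> <v, x> x] and [a' = a t + t a]. Since [<x, x> a - a'] commutes with
    [t], [Delta a'] and [<x, x> Delta a] have the same value at the vector
    functional of [x], and the trace identity for the pair [(a', t)] turns it
    into [- tr (a' Delta(t))]. This is linear in [a], so [Delta] is linear by
    polarization.

    Linearity makes [B(x, y; v, w) = <Delta(x (x) y) v, w>] multilinear; it is
    antisymmetric under exchanging [(x, y)] and [(v, w)] and vanishes when
    [v _|_ y] and [x _|_ w]. These properties force
    [B = <v, y> <z x, w> - <x, w> <z v, y>] for a linear [z], which means that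
    [Delta] is the commutator with [z] on rank-one operators, and the formula
    above extends this to all of [B(H)]. *)

Section InnerProduct.
Variables (R : realType) (V : lmodType R[i]) (ip : V -> V -> R[i]).
Hypothesis ipP : inner_product ip.
Implicit Types (a b c : R[i]) (x y z v w : V) (S T : V -> V).

Local Notation "''[' x , y ]" := (ip x y) (format "''[' x ,  y ]").
Local Notation "''|' x |" := (hnorm ip x) (format "''|' x |").

(** * Inner products and their norm *)

Let ipC x y : '[y, x] = '[x, y]^*%C. Proof. by case: ipP. Qed.
Let ip_ge0 x : 0 <= '[x, x]. Proof. by case: ipP. Qed.
Let ip_eq0 x : '[x, x] = 0 -> x = 0. Proof. by case: ipP => _ _ _; apply. Qed.
Let ip_linl a x y z : '[a *: x + y, z] = a * '[x, z] + '[y, z].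
Proof. by case: ipP. Qed.

Lemma ip0l z : '[0, z] = 0.
Proof.
have := ip_linl 1 0 0 z; rewrite scale1r mul1r addr0.
by move/(congr1 (fun t => t - '[0, z])); rewrite subrr addrK.
Qed.

Lemma ipDl x y z : '[x + y, z] = '[x, z] + '[y, z].
Proof. by have := ip_linl 1 x y z; rewrite scale1r mul1r. Qed.

Lemma ipZl a x z : '[a *: x, z] = a * '[x, z].
Proof. by have := ip_linl a x 0 z; rewrite !addr0 ip0l addr0. Qed.

Lemma ipNl x z : '[- x, z] = - '[x, z].
Proof. by rewrite -scaleN1r ipZl mulN1r. Qed.

Lemma ipDr x y z : '[x, y + z] = '[x, y] + '[x, z].
Proof. by rewrite ipC ipDl rmorphD /= -!ipC. Qed.

Lemma ipZr a x z : '[x, a *: z] = a^*%C * '[x, z].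
Proof. by rewrite ipC ipZl rmorphM /= -ipC. Qed.

Lemma ipNr x z : '[x, - z] = - '[x, z].
Proof. by rewrite ipC ipNl rmorphN /= -ipC. Qed.

Definition ipE := (ipDl, ipZl, ipNl, ipDr, ipZr, ipNr).

Lemma ip_ext x y : (forall w, '[x, w] = '[y, w]) -> x = y.
Proof.
move=> xy; apply/subr0_eq/ip_eq0.
by rewrite ipDl ipNl xy subrr.
Qed.

Lemma hnorm_ge0 x : 0 <= '|x|. Proof. by rewrite sqrtC_ge0. Qed.

Lemma hnorm_sqr x : '|x| ^+ 2 = '[x, x]. Proof. by rewrite sqrtCK. Qed.

Lemma hnorm0 : '|0| = 0. Proof. by rewrite /hnorm ip0l sqrtC0. Qed.

Lemma norm_ipC x y : `|'[y, x]| = `|'[x, y]|.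
Proof. by rewrite ipC; exact: norm_conjC. Qed.

Lemma cauchy_schwarz x y : `|'[x, y]| <= '|x| * '|y|.
Proof.
have [/ip_eq0 -> | y0] := eqVneq '[y, y] 0.
  by rewrite ipC ip0l rmorph0 normr0 hnorm0 mulr0.
have yp : 0 < '[y, y] by rewrite lt0r y0 ip_ge0.
rewrite -(@ler_pXn2r _ 2 isT) ?nnegrE ?normr_ge0 ?mulr_ge0 ?hnorm_ge0//.
rewrite exprMn !hnorm_sqr.
have -> : `|'[x, y]| ^+ 2 = '[x, y] * '[y, x] by rewrite normCK (ipC x y).
have := ip_ge0 ('[y, y] *: x - '[x, y] *: y).
have cyy : '[y, y]^*%C = '[y, y] by rewrite -ipC.
rewrite !ipE cyy -(ipC x y).
set A := (X in 0 <= X).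
have -> : A = '[y, y] * ('[x, x] * '[y, y] - '[x, y] * '[y, x]).
  by rewrite /A; ring.
by rewrite pmulr_rge0// subr_ge0.
Qed.

Lemma ler_hnormD x y : '|x + y| <= '|x| + '|y|.
Proof.
rewrite -(@ler_pXn2r _ 2 isT) ?nnegrE ?addr_ge0 ?hnorm_ge0//.
rewrite hnorm_sqr sqrrD !hnorm_sqr -(ger0_norm (ip_ge0 (x + y))) !ipE.
have -> : '[x, x] + '[x, y] + ('[y, x] + '[y, y]) =
  ('[x, x] + ('[x, y] + '[y, x])) + '[y, y] by ring.
rewrite (le_trans (ler_normD _ _))// (ger0_norm (ip_ge0 y)) lerD2r.
rewrite (le_trans (ler_normD _ _))// (ger0_norm (ip_ge0 x)) lerD2l.
rewrite (le_trans (ler_normD _ _))// (norm_ipC x y) -mulr2n.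
by rewrite lerMn2r cauchy_schwarz.
Qed.

Lemma hnormZ a x : '|a *: x| = `|a| * '|x|.
Proof.
apply/eqP; rewrite -(eqrXn2 (n := 2)) ?mulr_ge0 ?hnorm_ge0//.
by rewrite exprMn !hnorm_sqr !ipE mulrA normCK.
Qed.

Lemma unit_vector : (exists e, '[e, e] = 1) \/ (forall x y, x = y).
Proof.
have [[x x0]|V0] := pselect (exists x, x <> 0); [left|right]; last first.
  have {}V0 x : x = 0 by apply: contrapT => x0; apply: V0; exists x.
  by move=> x y; rewrite (V0 x) (V0 y).
have n0 : '|x| != 0.
  by apply/eqP => xn; apply/x0/ip_eq0; rewrite -hnorm_sqr xn expr0n.
exists ('|x|^-1 *: x); rewrite -hnorm_sqr hnormZ.
by rewrite ger0_norm ?invr_ge0 ?hnorm_ge0// mulVf// expr1n.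
Qed.

(** * Linear and bounded operators *)

Lemma linopD {T} x y : linop T -> T (x + y) = T x + T y.
Proof. by move=> lT; have := lT 1 x y; rewrite !scale1r. Qed.

Lemma linop0 {T} : linop T -> T 0 = 0.
Proof.
move=> lT; apply: (@addrI _ (T 0)).
by rewrite -(linopD _ _ lT) !addr0.
Qed.

Lemma linopZ {T} a x : linop T -> T (a *: x) = a *: T x.
Proof. by move=> lT; have := lT a x 0; rewrite (linop0 lT) !addr0. Qed.

Lemma linopN {T} x : linop T -> T (- x) = - T x.
Proof. by move=> lT; rewrite -(scaleN1r x) linopZ// scaleN1r. Qed.

Definition linopE T (lT : linop T) :=
  (fun x y => linopD x y lT, fun a x => linopZ a x lT, fun x => linopN x lT).

(** A bound may be any complex scalar; but [M * '|x|] dominates a norm, so it is nonnegative and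
    equals its own modulus. *)
Lemma bop_bound {T} : bop ip T -> exists2 M, 0 <= M & opbound ip M T.
Proof.
move=> [_ [M bT]]; exists `|M| => // x; apply: le_trans (bT x) _.
have : 0 <= M * '|x| := le_trans (hnorm_ge0 _) (bT x).
by move/ger0_norm <-; rewrite normrM (ger0_norm (hnorm_ge0 x)).
Qed.

Lemma bop_comb {S T} a : bop ip T -> bop ip S ->
  bop ip (fun x => a *: T x + S x).
Proof.
move=> bT bS; have [[lT _] [lS _]] := (bT, bS).
have [[M M0 bM] [N N0 bN]] := (bop_bound bT, bop_bound bS).
split=> [b x y|]; first by rewrite lT lS !scalerDr !scalerA (mulrC a b) addrACA.
exists (`|a| * M + N) => x; apply: le_trans (ler_hnormD _ _) _.
by rewrite mulrDl lerD// hnormZ -mulrA ler_wpM2l.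
Qed.

Lemma bop_comp {S T} : bop ip T -> bop ip S -> bop ip (fun x => T (S x)).
Proof.
move=> bT bS; have [[lT _] [lS _]] := (bT, bS).
have [[M M0 bM] [N N0 bN]] := (bop_bound bT, bop_bound bS).
split=> [b x y|]; first by rewrite lS lT.
exists (M * N) => x; apply: le_trans (bM _) _.
by rewrite -mulrA ler_wpM2l.
Qed.

(** * Rank-one operators and trace functionals *)

Definition rank1 x y : V -> V := fun v => '[v, y] *: x.

Lemma bop_rank1 x y : bop ip (rank1 x y).
Proof.
split=> [a v w|]; first by rewrite /rank1 !ipE scalerDl scalerA.
exists ('|x| * '|y|) => v; rewrite hnormZ mulrC -mulrA.
by rewrite ler_wpM2l ?hnorm_ge0// mulrC cauchy_schwarz.
Qed.

Lemma rank1_linear a x x' y :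
  rank1 (a *: x + x') y = (fun v => a *: rank1 x y v + rank1 x' y v).
Proof. by apply/funext => v; rewrite /rank1 scalerDr !scalerA mulrC. Qed.

Lemma rank1_antilinear a x y y' :
  rank1 x (a *: y + y') = (fun v => a^*%C *: rank1 x y v + rank1 x y' v).
Proof. by apply/funext => v; rewrite /rank1 !ipE scalerDl scalerA. Qed.

Lemma bdualD (phi psi : (V -> V) -> R[i]) :
  bdual ip phi -> bdual ip psi -> bdual ip (fun T => phi T + psi T).
Proof.
move=> [lphi [C bphi]] [lpsi [E bpsi]]; split=> [a T S bT bS|].
  by rewrite lphi// lpsi//; ring.
exists (C + E) => T M bT M0 bM; rewrite mulrDl.
by rewrite (le_trans (ler_normD _ _))// lerD ?bphi ?bpsi.
Qed.

Lemma bdualN (phi : (V -> V) -> R[i]) :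
  bdual ip phi -> bdual ip (fun T => - phi T).
Proof.
move=> [lphi [C bphi]]; split=> [a T S bT bS|].
  by rewrite lphi//; ring.
by exists C => T M bT M0 bM; rewrite normrN bphi.
Qed.

(** This is the functional [T |-> tr (c T)] with [c] the composite of [S] followed by
    [rank1 v w]. *)
Lemma bdual_ip {S} v w : bop ip S -> bdual ip (fun T => '[S (T v), w]).
Proof.
move=> bS; have [[lS _] [N N0 bN]] := (bS, bop_bound bS).
split=> [a T U bT bU|]; first by rewrite lS !ipE.
exists (N * '|v| * '|w|) => T M bT M0 bM.
apply: le_trans (cauchy_schwarz _ _) _.
rewrite mulrAC ler_wpM2r ?hnorm_ge0//; apply: le_trans (bN _) _.
by rewrite -mulrA ler_wpM2l// mulrC.
Qed.

Lemma bop_id : bop ip id.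
Proof. by split=> //; exists 1 => x; rewrite mul1r. Qed.

(** * Sesquilinear forms and polarization *)

Definition sesquilinear (B : V -> V -> R[i]) : Prop :=
  (forall a x y z, B (a *: x + y) z = a * B x z + B y z) /\
  (forall a x y z, B x (a *: y + z) = a^*%C * B x y + B x z).

Lemma sesq_diag0 B : sesquilinear B -> (forall x, B x x = 0) ->
  forall x y, B x y = 0.
Proof.
move=> [Bl Br] B0 x y.
(* The values [a = 1] and [a = 'i] give two equations that force [B x y = 0]. *)
have h a : a * B x y + a^*%C * B y x = 0.
  have := B0 (a *: x + y); rewrite Bl !Br !B0 !mulr0 add0r addr0; exact.
have /eqP := h 1; rewrite rmorph1 !mul1r addrC addr_eq0 => /eqP Byx.
have := h 'i; rewrite Byx.
have -> : ('i : R[i])^*%C = - 'i.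
  by apply/eqP; rewrite eq_complex /= oppr0 !eqxx.
rewrite mulrNN -mulr2n => /eqP; rewrite mulrn_eq0 /= mulf_eq0.
by rewrite complexiE (negPf (neq0Ci _)) => /eqP.
Qed.

(** If ['[e, w] != 0], subtracting a multiple of [e] from [x] makes it orthogonal to [w], which
    reduces [B x w] to [B e w]; the same device in the second variable reduces that to [B e e]. *)
Lemma sesq_orth B e : sesquilinear B -> '[e, e] = 1 ->
  (forall x w, '[x, w] = 0 -> B x w = 0) ->
  forall x w, B x w = '[x, w] * B e e.
Proof.
move=> [Bl Br] e1 B0.
have aux x w : '[e, w] != 0 -> B x w = '[x, w] * ('[e, w]^-1 * B e w).
  move=> ew; have := B0 (- ('[x, w] / '[e, w]) *: e + x) w.
  rewrite Bl !ipE mulNr divfK// addNr => /(_ erefl)/eqP.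
  by rewrite addrC mulNr subr_eq0 mulrA => /eqP.
have eB w : B e w = '[e, w] * B e e.
  have := B0 e (- '[w, e] *: e + w).
  rewrite Br !ipE rmorphN /= -ipC e1 mulr1 addNr => /(_ erefl)/eqP.
  by rewrite addrC mulNr subr_eq0 => /eqP.
have {}aux x w : '[e, w] != 0 -> B x w = '[x, w] * B e e.
  by move=> ew; rewrite aux// eB mulKf.
move=> x w; have [ew|/aux//] := eqVneq '[e, w] 0.
(* For [w] orthogonal to [e], apply the previous case to [e + w] and to [e], and subtract. *)
have e10 : '[e, e] != 0 by rewrite e1 oner_neq0.
have := aux x (1 *: e + w); rewrite Br !ipE rmorph1 !mul1r ew e1 addr0.
move/(_ (oner_neq0 _)); rewrite (aux x e)// mulrDl => /addrI; exact.
Qed.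

Lemma linop_ext {S T} : linop S -> linop T ->
  (forall x, '[S x, x] = '[T x, x]) -> forall x, S x = T x.
Proof.
move=> lS lT ST x; apply: ip_ext => w; apply/subr0_eq.
apply: (sesq_diag0 (B := fun x w => '[S x, w] - '[T x, w])) => [|y].
  by split=> a u v t; rewrite ?lS ?lT !ipE; ring.
by rewrite ST subrr.
Qed.

(** * Derivations as commutators *)

Definition comm (z T : V -> V) v := z (T v) - T (z v).

Lemma derivation_inner D : derivation ip D ->
  exists2 z : V -> V, linop z & forall T, bop ip T -> D T = comm z T.
Proof.
move=> [Dbop Dlin Dmul].
have [[e e1]|V0] := unit_vector; last first.
  by exists id => // T _; apply/funext => v; exact: V0.
(* Apply Leibniz to [T] composed with [rank1 v e], which is [rank1 (T v) e], and evaluate at [e]: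
   [z (T v) = D T v + T (z v)]. *)
exists (fun x => D (rank1 x e) e) => [a u v|T bT].
  by rewrite rank1_linear (Dlin _ _ _ (bop_rank1 _ _) (bop_rank1 _ _)).
apply/funext => v; have [lT _] := bT; rewrite /comm.
have -> : rank1 (T v) e = (fun w => T (rank1 v e w)).
  by apply/funext => w; rewrite /rank1 linopZ.
rewrite (Dmul _ _ bT (bop_rank1 v e)).
by rewrite /rank1 e1 scale1r addrK.
Qed.

(** * Linearity of weak-2-local derivations *)

Section WeakTwoLocal.
Variable Delta : (V -> V) -> (V -> V).
Hypothesis DeltaP : weak_2_local_star_derivation ip Delta.

Let Delta_bop T : bop ip T -> bop ip (Delta T).
Proof. by case: DeltaP => + _; apply. Qed.

Lemma weak_2_local_inner phi S T : bdual ip phi -> bop ip S -> bop ip T ->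
  exists2 z : V -> V, linop z &
    phi (Delta S) = phi (comm z S) /\ phi (Delta T) = phi (comm z T).
Proof.
move=> bphi bS bT; case: DeltaP => _ /(_ S T bS bT phi bphi)[D [[Dder _]]].
have [z lz Dz] := derivation_inner Dder.
by rewrite !Dz//; exists z.
Qed.

Lemma Delta_diag T x : bop ip T ->
  '[x, x] * '[Delta T x, x] =
  - '[Delta (rank1 x x) (T x), x] - '[T (Delta (rank1 x x) x), x].
Proof.
move=> bT; have [lT _] := bT.
have bt := bop_rank1 x x; set t := rank1 x x in bt *.
pose T' v := 1 *: T (t v) + t (T v).
have bT' : bop ip T' by apply: bop_comb; exact: bop_comp.
pose phi0 (S : V -> V) := '[S x, x].
pose phi1 (S : V -> V) := '[S (T x), x] + '[T (S x), x].
(* [phi0 = tr (t _)] and [phi1 = tr (T' _)]. *)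
have b0 : bdual ip phi0 := bdual_ip x x bop_id.
have b1 : bdual ip phi1 := bdualD (bdual_ip _ x bop_id) (bdual_ip x x bT).
(* As [t] squares to ['[x, x] t], [T'] and ['[x, x] T] have the same commutator with [t]. *)
have E1 : phi0 (Delta T') = '[x, x] * phi0 (Delta T).
  have [z lz [-> ->]] := weak_2_local_inner b0 bT' bT.
  rewrite /phi0 /comm /T' /t /rank1 !scale1r.
  by rewrite !(linopE lz, linopE lT, ipE); ring.
have E2 : phi1 (Delta T') = 0.
  have [z lz [-> _]] := weak_2_local_inner b1 bT' bT'.
  rewrite /phi1 /comm /T' /t /rank1 !scale1r.
  by rewrite !(linopE lz, linopE lT, ipE); ring.
have E3 : phi0 (Delta t) = 0.
  have [z lz [-> _]] := weak_2_local_inner b0 bt bt.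
  by rewrite /phi0 /comm /t /rank1 linopZ// !ipE; ring.
(* The functional is [tr ((T' - t) _)], which vanishes on the commutator of any [z] with
   [T' - t]. *)
have : phi1 (Delta T') + - phi0 (Delta T') = phi1 (Delta t) + - phi0 (Delta t).
  have [z lz [-> ->]] := weak_2_local_inner (bdualD b1 (bdualN b0)) bT' bt.
  rewrite /phi0 /phi1 /comm /T' /t /rank1 !scale1r.
  by rewrite !(linopE lz, linopE lT, ipE); ring.
rewrite E1 E2 E3 oppr0 addr0 add0r /phi1 -opprD => <-.
by rewrite opprK.
Qed.

Lemma Delta_blinear : blinear ip Delta.
Proof.
move=> a T S bT bS; have bTS := bop_comb a bT bS.
have bD := bop_comb a (Delta_bop bT) (Delta_bop bS).
apply/funext/(linop_ext (proj1 (Delta_bop bTS)) (proj1 bD)) => x.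
(* [Delta_diag] determines the diagonal value only after division by ['[x, x]]. *)
have [x0|x0] := eqVneq '[x, x] 0; first by rewrite (ip_eq0 x0) !(ipC 0) !ip0l.
apply: (mulfI x0); rewrite Delta_diag// !ipE mulrDr mulrCA.
rewrite (Delta_diag x bT) (Delta_diag x bS).
have [lt _] := Delta_bop (bop_rank1 x x).
by rewrite !(linopE lt) !ipE; ring.
Qed.

(** * The four-variable form and innerness *)

Let B x y v w := '[Delta (rank1 x y) v, w].

Let B_sesq_outer y v : sesquilinear (fun x w => B x y v w).
Proof.
split=> a x x' w; rewrite /B; last by rewrite !ipE.
by rewrite rank1_linear Delta_blinear ?ipE//; exact: bop_rank1.
Qed.

Let B_sesq_inner x w : sesquilinear (fun v y => B x y v w).
Proof.
split=> a v y u; rewrite /B.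
  by have [l _] := Delta_bop (bop_rank1 x u); rewrite l !ipE.
by rewrite rank1_antilinear Delta_blinear ?ipE//; exact: bop_rank1.
Qed.

(** [rank1 x y] kills [v], so its commutator with [z] sends [v] to a multiple of [x], which [w]
    annihilates. *)
Let B_orth x y v w : '[v, y] = 0 -> '[x, w] = 0 -> B x y v w = 0.
Proof.
move=> vy xw; have bt := bop_rank1 x y.
have [z lz [E _]] := weak_2_local_inner (bdual_ip v w bop_id) bt bt.
rewrite /B E /comm /rank1 vy scale0r (linop0 lz) !ipE ip0l xw; ring.
Qed.

(** Expand [tr (S (Delta S)) = 0] for [S = rank1 x y + rank1 v w]: the diagonal terms vanish and the
    two cross terms remain. *)
Let B_anti x y v w : B x y v w = - B v w x y.
Proof.
have b x1 y1 := bop_rank1 x1 y1.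
pose S u := 1 *: rank1 x y u + rank1 v w u.
have bS : bop ip S := bop_comb 1 (b x y) (b v w).
have bD p q := bdual_ip p q bop_id.
have diag p q : B p q p q = 0.
  have [z lz [E _]] := weak_2_local_inner (bD p q) (b p q) (b p q).
  by rewrite /B E /comm /rank1 linopZ// !ipE; ring.
have := diag x y; have := diag v w; rewrite /B => dv dx.
have [z lz [+ _]] := weak_2_local_inner (bdualD (bD x y) (bD v w)) bS bS.
rewrite Delta_blinear// !ipE dv dx mulr0 add0r addr0 mul1r => E.
apply/eqP; rewrite -addr_eq0 addrC; apply/eqP.
rewrite E /comm /S /rank1 !scale1r.
by rewrite !(linopE lz, ipE); ring.
Qed.

Lemma Delta_inner :
  exists2 z : V -> V, linop z & forall T, bop ip T -> Delta T = comm z T.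
Proof.
have [[e e1]|V0] := unit_vector; last first.
  by exists id => // T _; apply/funext => v; exact: V0.
pose z x := Delta (rank1 x e) e.
have lz : linop z.
  by move=> a u v; rewrite /z rank1_linear Delta_blinear//; exact: bop_rank1.
have Bz x y v w : B x y v w = '[v, y] * '[z x, w] - '[x, w] * '[z v, y].
  have zee : '[z e, e] = 0.
    have /eqP := B_anti e e e e.
    by rewrite -addr_eq0 -mulr2n mulrn_eq0 => /eqP.
  (* For [v'] orthogonal to [y'], the form in [(x, w)] is a multiple of the inner product;
     antisymmetry turns its value at [(e, e)] into [- '[z v', y']]. *)
  have B0 v' y' : '[v', y'] = 0 -> B x y' v' w = - '[x, w] * '[z v', y'].
    move=> vy; rewrite (sesq_orth (B_sesq_outer y' v') e1) => [|u u' uu'].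
      by rewrite (B_anti e y') mulrN mulNr.
    exact: B_orth.
  (* The corrected form vanishes on orthogonal pairs [(v, y)]; its value at [(e, e)] is
     ['[z x, w]]. *)
  have := sesq_orth (B := fun v y => B x y v w + '[x, w] * '[z v, y]) _ e1 _ v y.
  rewrite zee mulr0 addr0 => H; apply/eqP; rewrite eq_sym subr_eq; apply/eqP.
  rewrite -H//.
    have [Bl Br] := B_sesq_inner x w.
    by split=> a u u' t; rewrite ?Bl ?Br ?lz !ipE; ring.
  by move=> v' y' /B0 ->; rewrite mulNr addNr.
exists z => // T bT; have [lT _] := bT.
have lc : linop (comm z T).
  by move=> a u v; rewrite /comm !(lT, lz) scalerBr opprD addrACA.
apply/funext/(linop_ext (proj1 (Delta_bop bT)) lc) => x.
have [x0|x0] := eqVneq '[x, x] 0; first by rewrite (ip_eq0 x0) !(ipC 0) !ip0l.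
apply: (mulfI x0); rewrite Delta_diag//.
have -> : Delta (rank1 x x) x = '[x, x] *: z x - '[z x, x] *: x.
  by apply: ip_ext => w; rewrite [LHS]Bz !ipE; ring.
rewrite [X in - X - _]Bz !(linopE lT) /comm !ipE.
ring.
Qed.

(** [is_adjoint] does not assume [S] bounded, while the local hypothesis speaks of bounded
    operators. The bound comes from ['[S x, S x] = '[T (S x), x]]. *)
Lemma bop_adjoint T S : bop ip T -> is_adjoint ip T S -> bop ip S.
Proof.
move=> /bop_bound[M M0 bM] TS; split.
  move=> a x y; apply: ip_ext => w; rewrite [LHS]ipC [RHS]ipC; congr (_^*%C).
  by rewrite -TS !ipE !TS.
exists M => x; have [->|S0] := eqVneq '|S x| 0.
  by rewrite mulr_ge0 ?hnorm_ge0.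
rewrite -(@ler_pM2l _ '|S x|); last by rewrite lt0r S0 hnorm_ge0.
rewrite -expr2 hnorm_sqr -(ger0_norm (ip_ge0 (S x))) -TS.
apply: le_trans (cauchy_schwarz _ _) _.
by rewrite mulrA ler_wpM2r ?hnorm_ge0// mulrC bM.
Qed.

(** A single local derivation serves the pair [(T, S)] at the vector functional of [u]; its
    compatibility with adjoints gives the diagonal identity, and polarization the rest. *)
Lemma Delta_adjoint T S : bop ip T -> is_adjoint ip T S ->
  is_adjoint ip (Delta T) (Delta S).
Proof.
move=> bT TS; have bS := bop_adjoint bT TS.
have [[lT _] [lS _]] := (Delta_bop bT, Delta_bop bS).
move=> x y; apply/subr0_eq.
apply: (sesq_diag0 (B := fun x y => '[Delta T x, y] - '[x, Delta S y])) => [|u].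
  by split=> a u v w; rewrite ?lT ?lS !ipE; ring.
case: DeltaP => _ /(_ T S bT bS _ (bdual_ip u u bop_id))[D [[_ Dadj] [-> DS]]].
by rewrite (ipC (Delta S u)) DS -ipC (Dadj T S)// subrr.
Qed.

Lemma Delta_star_derivation : star_derivation ip Delta.
Proof.
split; last exact: Delta_adjoint.
split; [exact: Delta_bop | exact: Delta_blinear |].
move=> T S bT bS; have [z lz DE] := Delta_inner.
have [lT _] := bT; rewrite !DE//; last exact: bop_comp.
apply/funext => v; rewrite /comm !(linopE lT).
by rewrite addrA subrK.
Qed.

End WeakTwoLocal.
End InnerProduct.

Theorem theorem3p10 (R : realType) (V : lmodType R[i]) (ip : V -> V -> R[i])
  (hH : hilbert_space ip) (sepH : hseparable ip)
  (Delta : (V -> V) -> (V -> V)) :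
  weak_2_local_star_derivation ip Delta ->
  blinear ip Delta /\ star_derivation ip Delta.
Proof.
have [ipP _] := hH => DeltaP.
split; [exact: Delta_blinear ipP _ DeltaP | exact: Delta_star_derivation].
Qed.
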